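(* Let $2\le q\le p$ be integers. Suppose that $h=0$ (so $w=f$), that all accuracies are equal, $\epsilon_j=\epsilon$ for $j\in\{1,\dots,q\}$, and that either $q>2$, or $q=2$ and $\mathcal F=\mathbb R^n$. If the AR$qp$C algorithm (see context) applied to minimize $f$ allows the choice of arbitrary radii $\delta_{k,j}>0$ satisfying $$\delta_{k,j}\ge\kappa_{\delta,\min}\,\epsilon_j ,\qquad j\in\{1,\dots,q\}$$ (with $\kappa_{\delta,\min}\in(0,\tfrac12)$ defined in the context), then it may require $$\epsilon^{-\frac{q(p+1)}{p}}$$ iterations and evaluations of $f$ and of its derivatives of order one up to $p$ to produce a point $x_\epsilon$ such that $\phi_{f,j}^{\delta_{\epsilon,j}}(x_\epsilon)\le\epsilon\,\delta_{\epsilon,j}^j/j!$ for all $j\in\{1,\dots,q\}$ and some $\delta_\epsilon\in(0,1]^q$. That is: for $\epsilon\in(0,1)$ there exist a problem of the stated type (with $h=0$ and $f$ satisfying AS.1 and AS.4), a starting point, algorithm parameters and an admissible execution of the algorithm, with radii obeying the lower bound $\delta_{k,j}\ge\kappa_{\delta,\min}\,\epsilon_j$ for $j\in\{1,\dots,q\}$, for which at least $\epsilon^{-q(p+1)/p}$ iterations, and as many evaluations of $f$ and of its derivatives of orders one to $p$, are performed before the algorithm terminates with such a point $x_\epsilon$.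
   Context: Problem. $n,p,q\ge1$ are integers with $q\le p$; $\mathcal F\subseteq\mathbb R^n$ is a nonempty feasible set; in the non-composite case $h=0$ one minimizes $w(x)=f(x)$ over $x\in\mathcal F$, $f:\mathbb R^n\to\mathbb R$. $\|\cdot\|$ is the Euclidean norm, or the induced operator norm for tensors. Minima written below are implicitly assumed to be attained. Assumptions. - AS.1: $f$ is $p$ times continuously differentiable and, for every $j\in\{1,\dots,p\}$, there is $L_{f,j}\ge1$ with $\|\nabla_x^jf(x)-\nabla_x^jf(y)\|\le L_{f,j}\|x-y\|$ for all $x,y$ in a convex open neighbourhood of $\mathcal F$. - AS.4: there is $w_{\rm low}$ with $w(x)\ge w_{\rm low}$ for all $x\in\mathcal F$. Taylor models and optimality measure (for $h=0$). $T_{w,j}(x,s)=T_{f,j}(x,s)=\sum_{\ell=0}^j\frac1{\ell!}\nabla_x^\ell f(x)[s]^\ell$; for $\delta>0$, $\phi_{w,j}^{\delta}(x)=\phi_{f,j}^\delta(x)=f(x)-\min_{x+d\in\mathcal F,\ \|d\|\le\delta}T_{f,j}(x,d)$. Regularized model at iteration $k$: $m_k(s)=T_{f,p}(x_k,s)+\frac{\sigma_k}{(p+1)!}\|s\|^{p+1}$, with optimality measure $\phi_{m_k,j}^{\delta}(s)=m_k(s)-\min_{x_k+s+d\in\mathcal F,\ \|d\|\le\delta}\sum_{\ell=0}^j\frac1{\ell!}\nabla_s^\ell m_k(s)[d]^\ell$ for $j\le q$. Algorithm AR$qp$C. - Step 0: given are $x_0\in\mathcal F$, $\sigma_0>0$,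 accuracies $\epsilon_1,\dots,\epsilon_q\in(0,1)$, $\delta_0\in(0,1]^q$, $\theta\in(0,1)$, $\sigma_{\min}\in(0,\sigma_0]$, $0<\eta_1\le\eta_2<1$, $0<\gamma_1<1<\gamma_2<\gamma_3$. Compute $w(x_0)$; set $k=0$. - Step 1: evaluate the derivatives of $f$ at $x_k$ of orders $1,\dots,q$. If $\phi_{w,j}^{\delta_{k,j}}(x_k)\le\epsilon_j\delta_{k,j}^j/j!$ for all $j\in\{1,\dots,q\}$, terminate with $x_\epsilon=x_k$. Otherwise evaluate the derivatives of orders $q+1,\dots,p$. - Step 2: compute a nonzero step $s_k$ with $x_k+s_k\in\mathcal F$ and radii $\delta_s\in(0,1]^q$ such that $m_k(s_k)\le m_k(0)$ and $\phi_{m_k,j}^{\delta_{s,j}}(s_k)\le\theta\epsilon_j\delta_{s,j}^j/j!$ for all $j\in\{1,\dots,q\}$. If no such pair exists, terminate with $x_\epsilon=x_k$. - Step 3: compute $w(x_k+s_k)$ and $\rho_k=\dfrac{w(x_k)-w(x_k+s_k)}{w(x_k)-T_{w,p}(x_k,s_k)}$. If $\rho_k\ge\eta_1$ set $x_{k+1}=x_k+s_k$, $\delta_{k+1}=\delta_s$ (successful iteration); otherwise $x_{k+1}=x_k$, $\delta_{k+1}=\delta_k$. - Step 4: choose $\sigma_{k+1}\in[\max(\sigma_{\min},\gamma_1\sigma_k),\sigma_k]$ if $\rho_k\ge\eta_2$; $\sigma_{k+1}\in[\sigma_k,\gamma_2\sigma_k]$ if $\rho_k\in[\eta_1,\eta_2)$;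 $\sigma_{k+1}\in[\gamma_2\sigma_k,\gamma_3\sigma_k]$ if $\rho_k<\eta_1$. Increment $k$; go to Step 1 if the iteration just completed was successful, to Step 2 otherwise. Constants (for $h=0$). $\kappa_{\delta,\min}=\dfrac{\theta}{2\,q!\,(6L_w+3\sigma_{\max})}$, where $L_w=\max_{j\in\{1,\dots,p\}}L_{f,j-1}$ (with $L_{f,0}\ge1$ a fixed constant) and $\sigma_{\max}=\max\big[\sigma_0,\frac{\gamma_3L_{f,p}}{1-\eta_2}\big]$ is an upper bound on all $\sigma_k$. *)

(* Defs.v *)
From HB Require Import structures.
From mathcomp Require Import all_boot all_order all_algebra.
From mathcomp Require Import all_classical all_reals all_analysis.

Set Implicit Arguments.
Unset Strict Implicit.
Unset Printing Implicit Defensive.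
Import Order.TTheory GRing.Theory Num.Theory.
Import numFieldNormedType.Exports.

Local Open Scope classical_set_scope.
Local Open Scope ring_scope.

(* The library norm on 'rV[R]_n is the maximum norm; it is used here only
   through the topology it induces. *)
Definition enorm (R : realType) (n : nat) (v : 'rV[R]_n) : R :=
  Num.sqrt (\sum_(i < n) v 0 i ^+ 2).

(* nderiv f [:: v1; ...; vj] x is the derivative tensor of order j of f at x,
   applied to (v1, ..., vj). *)
Fixpoint nderiv (R : realType) (n : nat) (f : 'rV[R]_n -> R)
    (vs : seq 'rV[R]_n) : 'rV[R]_n -> R :=
  if vs is v :: vs' then fun x => 'D_v (nderiv f vs') x else f.

Definition times_cont_differentiable (R : realType) (n p : nat)
    (f : 'rV[R]_n -> R) : Prop :=
  (forall vs x, (size vs < p)%N -> differentiable (nderiv f vs) x) /\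
  (forall vs, (size vs <= p)%N -> continuous (nderiv f vs)).

(* Operator norm of a tensor of order j; it is extended-real valued so that no
   finiteness has to be presupposed. *)
Definition tensor_norm (R : realType) (n j : nat)
    (T : j.-tuple 'rV[R]_n -> R) : \bar R :=
  ereal_sup [set (`|T v|)%:E |
             v in [set v : j.-tuple 'rV[R]_n | forall i, enorm (tnth v i) = 1]].

Definition AS1 (R : realType) (n p : nat) (F : set 'rV[R]_n)
    (f : 'rV[R]_n -> R) (L : nat -> R) : Prop :=
  [/\ times_cont_differentiable p f,
      forall j, (1 <= j <= p)%N -> 1 <= L j &
      exists U : set 'rV[R]_n,
        [/\ open U, convex_set U, F `<=` U &
            forall j x y, (1 <= j <= p)%N -> U x -> U y ->
              (tensor_norm (fun v : j.-tuple 'rV[R]_n =>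
                              (nderiv f v x - nderiv f v y)%R)
               <= (L j * enorm (x - y))%:E)%E]].

Definition AS4 (R : realType) (n : nat) (F : set 'rV[R]_n)
    (f : 'rV[R]_n -> R) (wlow : R) : Prop :=
  forall x, F x -> wlow <= f x.

Definition taylor (R : realType) (n : nat) (f : 'rV[R]_n -> R) (j : nat)
    (x s : 'rV[R]_n) : R :=
  \sum_(l < j.+1) (l`!%:R)^-1 * nderiv f (nseq l s) x.

Definition trust_region (R : realType) (n : nat) (G : set 'rV[R]_n)
    (delta : R) (x : 'rV[R]_n) : set 'rV[R]_n :=
  [set d | G (x + d) /\ enorm d <= delta].

(* The optimality measure of order j of an arbitrary function g over an
   arbitrary set G: for the objective take g = f and G = F; for the regularized
   model take g = m_k and G = [set s | F (x_k + s)]. *)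
Definition phi (R : realType) (n : nat) (G : set 'rV[R]_n)
    (g : 'rV[R]_n -> R) (j : nat) (delta : R) (x : 'rV[R]_n) : R :=
  g x - inf [set taylor g j x d | d in trust_region G delta x].

(* The minima defining the measures of orders 1, ..., q are attained, so that
   the infimum in phi is a minimum. *)
Definition minima_attained (R : realType) (n q : nat) (G : set 'rV[R]_n)
    (g : 'rV[R]_n -> R) (delta : nat -> R) (x : 'rV[R]_n) : Prop :=
  forall j, (1 <= j <= q)%N ->
    exists2 d, trust_region G (delta j) x d &
      forall d', trust_region G (delta j) x d' ->
        taylor g j x d <= taylor g j x d'.

(* Radii and accuracies are indexed by the orders 1, ..., q; their values at
   the other indices are irrelevant. *)
Definition radii (R : realType) (q : nat) (delta : nat -> R) : Prop :=
  forall j, (1 <= j <= q)%N -> 0 < delta j <= 1.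

Definition approx_minimizer (R : realType) (n q : nat) (G : set 'rV[R]_n)
    (g : 'rV[R]_n -> R) (tol delta : nat -> R) (x : 'rV[R]_n) : Prop :=
  forall j, (1 <= j <= q)%N ->
    phi G g j (delta j) x <= tol j * delta j ^+ j / j`!%:R.

Record parameters (R : realType) := MkParameters {
  theta : R; sigma0 : R; sigma_min : R; eta1 : R; eta2 : R;
  gamma1 : R; gamma2 : R; gamma3 : R }.

Definition valid_parameters (R : realType) (P : parameters R) : Prop :=
  [/\ 0 < theta P < 1,
      0 < sigma_min P <= sigma0 P,
      [/\ 0 < eta1 P, eta1 P <= eta2 P & eta2 P < 1],
      0 < gamma1 P < 1 &
      1 < gamma2 P < gamma3 P].

Definition reg_model (R : realType) (n p : nat) (f : 'rV[R]_n -> R)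
    (x : 'rV[R]_n) (sigma : R) (s : 'rV[R]_n) : R :=
  taylor f p x s + sigma / (p.+1)`!%:R * enorm s ^+ p.+1.

Definition acceptable_step (R : realType) (n p q : nat) (F : set 'rV[R]_n)
    (f : 'rV[R]_n -> R) (P : parameters R) (eps : nat -> R) (x : 'rV[R]_n)
    (sigma : R) (s : 'rV[R]_n) (delta_s : nat -> R) : Prop :=
  let m := reg_model p f x sigma in
  [/\ s != 0, F (x + s), radii q delta_s, m s <= m 0 &
      approx_minimizer q [set u | F (x + u)] m
        (fun j => theta P * eps j) delta_s s].

(* The data of a run that performs the iterations 0, ..., niter - 1 completely
   and terminates during iteration niter. *)
Record trace (R : realType) (n : nat) := Trace {
  niter : nat;
  iterate : nat -> 'rV[R]_n;
  step : nat -> 'rV[R]_n;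
  sigma : nat -> R;
  delta : nat -> nat -> R;     (* delta k j *)
  delta_s : nat -> nat -> R }.

Definition rho (R : realType) (n p : nat) (f : 'rV[R]_n -> R)
    (t : trace R n) (k : nat) : R :=
  let x := iterate t k in let s := step t k in
  (f x - f (x + s)) / (f x - taylor f p x s).

Definition successful (R : realType) (n p : nat) (f : 'rV[R]_n -> R)
    (P : parameters R) (t : trace R n) (k : nat) : bool :=
  eta1 P <= rho p f t k.

(* Step 1 is skipped after an unsuccessful iteration. *)
Definition step1_visited (R : realType) (n p : nat) (f : 'rV[R]_n -> R)
    (P : parameters R) (t : trace R n) (k : nat) : bool :=
  (k == 0)%N || successful p f P t k.-1.

Definition step1_test (R : realType) (n q : nat) (F : set 'rV[R]_n)
    (f : 'rV[R]_n -> R) (eps : nat -> R) (t : trace R n) (k : nat) : Prop :=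
  approx_minimizer q F f eps (delta t k) (iterate t k).

Definition sigma_update (R : realType) (P : parameters R)
    (rho sigma sigma' : R) : Prop :=
  if eta2 P <= rho then Num.max (sigma_min P) (gamma1 P * sigma) <= sigma' <= sigma
  else if eta1 P <= rho then sigma <= sigma' <= gamma2 P * sigma
  else gamma2 P * sigma <= sigma' <= gamma3 P * sigma.

Definition iteration (R : realType) (n p q : nat) (F : set 'rV[R]_n)
    (f : 'rV[R]_n -> R) (P : parameters R) (eps : nat -> R) (t : trace R n)
    (k : nat) : Prop :=
  [/\ step1_visited p f P t k -> ~ step1_test q F f eps t k,
      acceptable_step p q F f P eps (iterate t k) (sigma t k)
        (step t k) (delta_s t k),
      iterate t k.+1 = (if successful p f P t k
                        then iterate t k + step t k else iterate t k),
      delta t k.+1 = (if successful p f P t k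
                      then delta_s t k else delta t k) &
      sigma_update P (rho p f t k) (sigma t k) (sigma t k.+1)].

Definition terminates_at (R : realType) (n p q : nat) (F : set 'rV[R]_n)
    (f : 'rV[R]_n -> R) (P : parameters R) (eps : nat -> R) (t : trace R n)
    (k : nat) : Prop :=
  (step1_visited p f P t k /\ step1_test q F f eps t k) \/
  ((step1_visited p f P t k -> ~ step1_test q F f eps t k) /\
   ~ exists s d,
       acceptable_step p q F f P eps (iterate t k) (sigma t k) s d).

Definition execution (R : realType) (n p q : nat) (F : set 'rV[R]_n)
    (f : 'rV[R]_n -> R) (P : parameters R) (eps : nat -> R)
    (x0 : 'rV[R]_n) (delta0 : nat -> R) (t : trace R n) : Prop :=
  [/\ [/\ iterate t 0 = x0, sigma t 0 = sigma0 P & delta t 0 = delta0],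
      forall k, (k < niter t)%N -> iteration p q F f P eps t k,
      terminates_at p q F f P eps t (niter t),
      forall k, (k <= niter t)%N ->
        minima_attained q F f (delta t k) (iterate t k) &
      forall k, (k < niter t)%N ->
        minima_attained q [set u | F (iterate t k + u)]
          (reg_model p f (iterate t k) (sigma t k)) (delta_s t k) (step t k)].

(* f is evaluated at x_0 and at every trial point x_k + s_k. *)
Definition function_evaluations (R : realType) (n : nat) (t : trace R n) : nat :=
  (niter t).+1.

(* The orders 1, ..., q are evaluated on each visit to Step 1, the orders
   q+1, ..., p only if that visit does not terminate the algorithm. *)
Definition derivative_evaluations (R : realType) (n p q : nat)
    (F : set 'rV[R]_n) (f : 'rV[R]_n -> R) (P : parameters R)
    (eps : nat -> R) (t : trace R n) (l : nat) : nat :=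
  count (fun k => step1_visited p f P t k &&
                  ((l <= q)%N || ~~ `[< step1_test q F f eps t k >]))
        (iota 0 (niter t).+1).

Definition sigma_max (R : realType) (p : nat) (L : nat -> R)
    (P : parameters R) : R :=
  Num.max (sigma0 P) (gamma3 P * L p / (1 - eta2 P)).

(* Since p >= 1, the index 0 occurs among the i < p and the initial value L 0
   of the maximum is harmless. *)
Definition Lw (R : realType) (p : nat) (L : nat -> R) : R :=
  \big[Num.max/L 0%N]_(i < p) L i.

Definition kappa_delta_min (R : realType) (p q : nat) (L : nat -> R)
    (P : parameters R) : R :=
  theta P / (2 * q`!%:R * (6 * Lw p L + 3 * sigma_max p L P)).

(* Main.v *)
Require Import Defs.
From HB Require Import structures.
From mathcomp Require Import all_boot all_order all_algebra.
From mathcomp Require Import all_classical all_reals all_analysis.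
From mathcomp Require Import zify ring lra.

Set Implicit Arguments.
Unset Strict Implicit.
Unset Printing Implicit Defensive.
Import Order.TTheory GRing.Theory Num.Theory.
Import numFieldNormedType.Exports.

Local Open Scope classical_set_scope.
Local Open Scope ring_scope.

(** The run lives on the whole real line. Left of the origin the objective is
    the line of slope -g, so that every Taylor model met there is linear and the
    measure of order j with radius delta equals g delta exactly. The test of
    order j therefore compares g with eps delta^(j-1) / j!, a bound that becomes
    small with delta when j >= 2. With all radii equal to kappa eps, where kappa is the
    smallest admissible factor, the test of order q fails as soon as
    g > kappa^(q-1) eps^q / q!. Twice this value is taken for g: it fails for
    radii kappa eps, but passes at all orders for radii 2 kappa eps
    ([radius_thresholds]). Thus the choice of the radii alone decides when the
    run stops.

    With unit regularization, the model of the linear objective is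
    c - g y + y^(p+1) / (p+1)!, which has its minimizer at s = (g p!)^(1/p), of
    order eps^(q/p). Its Taylor expansions at s have no term of order one, and
    the remaining terms have a nonnegative sum on radii below s 2^-(p+1)
    ([binomial_tail_ge0]), so that s is an acceptable step with all model
    measures zero ([phi_reg_model]). The prediction of the model is exact, hence
    rho = 1 at each iteration and the regularization parameter may stay equal
    to 1. One step decreases the objective by g s, which is of order
    eps^(q(p+1)/p). Hence a run of eps^(-q(p+1)/p) such steps decreases it by a
    bounded amount only. Starting so many steps left of the origin, it is stopped
    at the origin by doubling the radii.

    Right of the origin the line is continued to a function that is bounded
    below, p times continuously differentiable, and has Lipschitz derivatives,
    by multiplying it with e^{-x} times a Taylor polynomial of e^x
    ([profile_match0], [profile_bounds]). Since g <= 1, the Lipschitz constants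
    do not depend on eps.

    The step s has to be large compared to the radii. Because q <= p gives
    eps <= eps^(q/p), only the ratio of kappa to (g p!)^(1/p) eps^(-q/p)
    matters, and the parameter theta, which bounds kappa, is taken small enough
    for that ([step_scale]). *)

(** * Gluing two functions at the origin *)

Definition splice (R : realType) (u v : R -> R) (x : R) : R :=
  if x <= 0 then u x else v x.

Lemma splice_continuous0 (R : realType) (u v : R -> R) :
  u 0 = v 0 -> {for 0, continuous u} -> {for 0, continuous v} ->
  {for 0, continuous (splice u v)}.
Proof.
move=> uv /cvgrPdist_lt cu /cvgrPdist_lt cv; apply/cvgrPdist_lt => e e0.
have := cu e e0; have := cv e e0; rewrite -uv.
have -> : splice u v 0 = u 0 by rewrite /splice lexx.
by apply: filterS2 => x vx ux; rewrite /splice; case: ifP.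
Qed.

(** At the origin the difference quotients of the two pieces, seen as functions
    continuous there (Caratheodory), are glued in turn. *)
Lemma is_derive_splice (R : realType) (u v u' v' : R -> R) :
  (forall x : R, is_derive x 1 u (u' x)) ->
  (forall x : R, is_derive x 1 v (v' x)) ->
  u 0 = v 0 -> u' 0 = v' 0 ->
  forall x : R, is_derive x 1 (splice u v) (splice u' v' x).
Proof.
move=> du dv uv0 uv0' x.
have [x0|x0|->] := ltgtP x 0.
- rewrite /splice ltW//; apply: near_eq_is_derive (du x).
  by near=> y; rewrite ifT//; apply/ltW; near: y; exact: lt_nbhsl.
- rewrite /splice leNgt x0/=; apply: near_eq_is_derive (dv x).
  by near=> y; rewrite ifF//; apply/negbTE; rewrite -ltNge; near: y; exact: lt_nbhsr.
- have /is_derive1_caratheodory[a [ua ca a0]] := du 0.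
  have /is_derive1_caratheodory[b [vb cb b0]] := dv 0.
  apply/is_derive1_caratheodory; exists (splice a b); split.
  + by move=> z; rewrite /splice lexx; case: ifP; rewrite // uv0.
  + by apply: splice_continuous0 => //; rewrite a0 b0.
  + by rewrite /splice lexx.
Unshelve. all: by end_near. Qed.

Lemma splice_lipschitz (R : realType) (u v : R -> R) (C : R) :
  u 0 = v 0 ->
  (forall x y, x <= y -> y <= 0 -> `|u x - u y| <= C * (y - x)) ->
  (forall x y, 0 <= x -> x <= y -> `|v x - v y| <= C * (y - x)) ->
  forall x y, `|splice u v x - splice u v y| <= C * `|x - y|.
Proof.
move=> uv0 hu hv.
suff H x y : x <= y -> `|splice u v x - splice u v y| <= C * (y - x).
  move=> x y; have [xy|/ltW xy] := leP x y.
    by rewrite (distrC x) (ger0_norm (_ : 0 <= y - x)) ?subr_ge0// H.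
  by rewrite distrC (ger0_norm (_ : 0 <= x - y)) ?subr_ge0// H.
move=> xy; rewrite /splice; have [x0|x0] := leP x 0; have [y0|y0] := leP y 0.
- exact: hu.
- rewrite -[u x](subrK (u 0)) {2}uv0 -addrA (le_trans (ler_normD _ _))//.
  have -> : C * (y - x) = C * (0 - x) + C * (y - 0) by ring.
  by rewrite lerD// ?hu ?hv// ltW.
- by have := lt_le_trans x0 (le_trans xy y0); rewrite ltxx.
- by apply: hv => //; exact: ltW.
Qed.

(** * Polynomials times the decreasing exponential *)

(** The polynomial Q such that (P e^{-x})' = Q e^{-x}. *)
Definition pexp_deriv (R : realType) (P : {poly R}) : {poly R} := P^`() - P.

Definition pexp (R : realType) (P : {poly R}) (x : R) : R :=
  P.[x] * expR (- x).

Lemma is_derive_pexp (R : realType) (P : {poly R}) (x : R) :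
  is_derive x 1 (pexp P) (pexp (pexp_deriv P) x).
Proof.
have h : is_derive x 1 (expR \o -%R) (expR (- x) * (- 1)).
  exact: is_derive1_comp.
have -> : pexp P = (horner P : R -> R) * (expR \o -%R) by [].
apply: is_derive_eq.
rewrite /pexp /pexp_deriv hornerD hornerN /= /GRing.scale /=; ring.
Qed.

Lemma expRN_pow_le (R : realType) (x : R) (n : nat) :
  0 <= x -> x ^+ n * expR (- x) <= n`!%:R.
Proof.
move=> x0; rewrite expRN ler_pdivrMr ?expR_gt0//.
case: n => [|n].
  by rewrite expr0 mul1r -expR0 ler_expR.
have := expR_ge1Dxn n x0; set f := _`!%:R => h.
have f0 : 0 < f by rewrite ltr0n fact_gt0.
rewrite -ler_pdivrMl// mulrC (le_trans _ h)//.
by rewrite lerDr.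
Qed.

Lemma pexp_bounded (R : realType) (P : {poly R}) :
  exists C : R, forall x, 0 <= x -> `|pexp P x| <= C.
Proof.
exists (\sum_(i < size P) `|P`_i| * i`!%:R) => x x0.
rewrite /pexp horner_coef mulr_suml (le_trans (ler_norm_sum _ _ _))//.
apply: ler_sum => i _; rewrite -mulrA normrM ler_wpM2l//.
rewrite ger0_norm ?expRN_pow_le// mulr_ge0 ?expR_ge0//.
by rewrite exprn_ge0.
Qed.

Lemma pexp_lipschitz (R : realType) (P : {poly R}) (C : R) :
  (forall x, 0 <= x -> `|pexp (pexp_deriv P) x| <= C) ->
  forall x y, 0 <= x -> x <= y -> `|pexp P x - pexp P y| <= C * (y - x).
Proof.
move=> hC x y x0 xy; rewrite distrC.
have [||c] := @MVT_segment _ (pexp P) (pexp (pexp_deriv P)) _ _ xy.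
- by move=> z _; exact: is_derive_pexp.
- apply: derivable_within_continuous => z _.
  by have [] := is_derive_pexp P z.
rewrite in_itv /= => /andP[xc _] ->.
by rewrite normrM (ger0_norm (_ : 0 <= y - x)) ?subr_ge0// ler_wpM2r ?subr_ge0// hC// (le_trans x0).
Qed.
(** * The profile of the objective *)

Definition exp_trunc (R : realType) (n : nat) : {poly R} :=
  \sum_(m < n) (m`!%:R)^-1 *: 'X^m.

Definition cutoff_poly (R : realType) (p j : nat) : {poly R} :=
  iter j (@pexp_deriv R) ('X * exp_trunc R p).

(** The derivative of order j <= p of the function equal to x for x <= 0 and to
    x (sum_(m < p) x^m / m!) e^{-x} for x > 0. The two expressions agree to
    order p at the origin because the sum is a Taylor polynomial of e^x. *)
Definition profile (R : realType) (p j : nat) : R -> R :=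
  splice (horner (('X)^`(j))) (pexp (cutoff_poly R p j)).

Lemma deriv_exp_trunc (R : realType) (n : nat) :
  (exp_trunc R n.+1)^`() = exp_trunc R n.
Proof.
rewrite /exp_trunc linear_sum big_ord_recl /= derivZ derivXn mulr0n scaler0 add0r.
apply: eq_bigr => i _; rewrite derivZ /bump /= add1n derivXn /= -scalerMnr scalerMnl.
congr (_ *: _); rewrite factS natrM invfM -mulr_natl mulrA divff ?mul1r//.
Qed.

Lemma pexp_deriv_exp_trunc (R : realType) (n : nat) :
  pexp_deriv (exp_trunc R n.+1) = - ((n`!%:R)^-1 *: 'X^n).
Proof.
rewrite /pexp_deriv deriv_exp_trunc {2}/exp_trunc big_ord_recr /=.
by rewrite -/(exp_trunc R n) opprD addrA subrr add0r.
Qed.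

Lemma pexp_deriv_mulXn (R : realType) (m : nat) (Q : {poly R}) :
  exists Q' : {poly R}, pexp_deriv ('X^(m.+1) * Q) = 'X^m * Q'.
Proof.
exists (Q *+ m.+1 + 'X * (Q^`() - Q)).
rewrite /pexp_deriv derivM derivXn /= exprS -mulr_natl -[Q *+ _]mulr_natl; ring.
Qed.

Lemma cutoff_poly1 (R : realType) (n : nat) :
  cutoff_poly R n.+1 1 = exp_trunc R n.+1 - (n`!%:R)^-1 *: 'X^(n.+1).
Proof.
rewrite /cutoff_poly /= {1}/pexp_deriv derivM derivX mul1r.
have -> : (exp_trunc R n.+1)^`() =
          exp_trunc R n.+1 + pexp_deriv (exp_trunc R n.+1).
  by rewrite /pexp_deriv addrC subrK.
by rewrite pexp_deriv_exp_trunc exprS -!mul_polyC; ring.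
Qed.

(** Each application of P |-> P' - P lowers the order of vanishing at the origin
    by one, and the second of these polynomials already vanishes there to
    order p - 1. *)
Lemma cutoff_poly_vanish (R : realType) (n i : nat) : (i <= n)%N ->
  exists Q : {poly R}, cutoff_poly R n.+1 i.+2 = 'X^(n - i) * Q.
Proof.
elim: i => [_|i IH lin].
  rewrite subn0.
  have -> : cutoff_poly R n.+1 2 = pexp_deriv (cutoff_poly R n.+1 1) by [].
  rewrite cutoff_poly1.
  exists ((n`!%:R)^-1 *: ('X - (n.+2%:R)%:P)).
  rewrite {1}/pexp_deriv derivB derivZ derivXn /= deriv_exp_trunc.
  have -> : exp_trunc R n.+1 = exp_trunc R n + (n`!%:R)^-1 *: 'X^n.
    by rewrite /exp_trunc big_ord_recr.
  rewrite exprS -!mul_polyC -[_ *+ n.+1]mulr_natl [n.+2]lock polyCMn -lock.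
  by rewrite polyC1; ring.
have [Q EQ] := IH (ltnW lin).
have -> : cutoff_poly R n.+1 i.+3 = pexp_deriv (cutoff_poly R n.+1 i.+2) by [].
by rewrite EQ subnS -(@prednK (n - i)) ?subn_gt0//; exact: pexp_deriv_mulXn.
Qed.

Lemma profile_match0 (R : realType) (p j : nat) : (0 < p)%N -> (j <= p)%N ->
  ('X)^`(j).[0] = pexp (cutoff_poly R p j) 0.
Proof.
case: p => // n _; rewrite /pexp oppr0 expR0 mulr1.
case: j => [|[|j]] jn.
- by rewrite /cutoff_poly /= hornerM hornerX mul0r.
- rewrite derivn1 derivX cutoff_poly1 hornerD hornerN hornerZ hornerXn.
  rewrite expr0n mulr0 subr0 hornerC /exp_trunc horner_sum big_ord_recl /=.
  rewrite hornerZ hornerXn fact0 invr1 mul1r expr0 big1 ?addr0// => i _.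
  by rewrite hornerZ hornerXn expr0n mulr0.
- have [|Q ->] := @cutoff_poly_vanish R n j; first exact: ltnW.
  rewrite derivn_poly0 ?size_polyX// horner0 hornerM hornerXn expr0n.
  by rewrite subn_eq0 leqNgt -ltnS jn mul0r.
Qed.

Lemma profile0_le0 (R : realType) (p : nat) (x : R) : x <= 0 -> profile p 0 x = x.
Proof. by move=> x0; rewrite /profile /splice x0 derivn0 hornerX. Qed.

Lemma profile1_le0 (R : realType) (p : nat) (x : R) : x <= 0 -> profile p 1 x = 1.
Proof. by move=> x0; rewrite /profile /splice x0 derivn1 derivX hornerC. Qed.

Lemma profile_ge2_le0 (R : realType) (p j : nat) (x : R) :
  x <= 0 -> profile p j.+2 x = 0.
Proof.
by move=> x0; rewrite /profile /splice x0 derivn_poly0 ?size_polyX// horner0.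
Qed.

Lemma is_derive_profile (R : realType) (p j : nat) (x : R) : (j < p)%N ->
  is_derive x 1 (profile p j) (profile p j.+1 x).
Proof.
move=> jp; apply: is_derive_splice.
- by move=> y; exact: is_derive_pexp.
- by apply: profile_match0; [exact: leq_ltn_trans jp|exact: ltnW].
- by apply: profile_match0 => //; exact: leq_ltn_trans jp.
Qed.

Lemma cutoff_bounded (R : realType) (p : nat) :
  exists C : R, 1 <= C /\
    forall j x, (j <= p.+1)%N -> 0 <= x -> `|pexp (cutoff_poly R p j) x| <= C.
Proof.
suff [C [C1 CP]] : exists C : R, 1 <= C /\
    forall j x, (j < p.+2)%N -> 0 <= x -> `|pexp (cutoff_poly R p j) x| <= C.
  by exists C; split.
elim: p.+2 => [|m [C [C1 IH]]]; first by exists 1.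
have [D DP] := pexp_bounded (cutoff_poly R p m).
exists (Num.max C D); rewrite le_max C1; split => // j x.
rewrite ltnS leq_eqVlt le_max => /predU1P[->|jm] x0; first by rewrite DP// orbT.
by rewrite IH.
Qed.

(** The exponential beats the polynomials on the right, and on the left only the
    function itself, which is at most 0 there, fails to be constant. *)
Lemma profile_bounds (R : realType) (p : nat) : (0 < p)%N ->
  exists C : R, [/\ 1 <= C, forall x, profile p 0 x <= C &
    forall j x y, (1 <= j <= p)%N ->
      `|profile p j x - profile p j y| <= C * `|x - y|].
Proof.
move=> p0; have [C [C1 CP]] := cutoff_bounded R p; exists C; split => //.
- move=> x; rewrite /profile /splice; have [x0|x0] := leP x 0.
    by rewrite derivn0 hornerX (le_trans x0)// (le_trans _ C1).
  by rewrite (le_trans (ler_norm _))// CP// ltW.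
- move=> [//|j] x y /andP[_ jp]; apply: splice_lipschitz.
  + exact: profile_match0.
  + move=> a b ab _; have -> : (('X : {poly R})^`(j.+1)).[a] = ('X)^`(j.+1).[b].
      case: j {jp} => [|j]; first by rewrite derivn1 derivX !hornerC.
      by rewrite derivn_poly0 ?size_polyX// !horner0.
    by rewrite subrr normr0 mulr_ge0 ?subr_ge0// (le_trans _ C1).
  + by apply: pexp_lipschitz => z z0; exact: (CP j.+2).
Qed.

(** * Functions on one-dimensional row vectors *)

Lemma enorm1 (R : realType) (v : 'rV[R]_1) : enorm v = `|v 0 0|.
Proof. by rewrite /enorm big_ord1 sqrtr_sqr. Qed.

Lemma derive_coord (R : realType) (phi : R -> R) (a : R) (x w : 'rV[R]_1) :
  is_derive (x 0 0) 1 phi a ->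
  'D_w (fun v : 'rV[R]_1 => phi (v 0 0)) x = w 0 0 * a.
Proof.
move=> dphi.
have -> : 'D_w (fun v : 'rV[R]_1 => phi (v 0 0)) x = 'D_(w 0 0) phi (x 0 0).
  rewrite /derive; set F := (fun h => _); set G := (fun h => _).
  by rewrite (_ : F = G)//; apply/funext => h; rewrite /F /G /= !mxE.
have dif : differentiable phi (x 0 0) by apply/derivable1_diffP; case: dphi.
rewrite deriveE// diff1E// derive1E.
by case: dphi => _ ->.
Qed.

Lemma differentiable_coord1 (R : realType) (phi : R -> R) (a : R) (x : 'rV[R]_1) :
  is_derive (x 0 0) 1 phi a ->
  differentiable (fun v : 'rV[R]_1 => phi (v 0 0)) x.
Proof.
move=> dphi; apply: (@differentiable_comp _ _ _ _ (fun v : 'rV[R]_1 => v 0 0) phi).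
  exact: differentiable_coord.
by apply/derivable1_diffP; case: dphi.
Qed.

(** S is open because the identification is local: the regularized model is a
    polynomial only on one side of the origin. *)
Lemma nderiv_lift (R : realType) (S : set R) (m : nat) (D : nat -> R -> R)
    (f : 'rV[R]_1 -> R) :
  open S ->
  (forall x : 'rV[R]_1, S (x 0 0) -> f x = D 0%N (x 0 0)) ->
  (forall j (y : R), (j < m)%N -> S y -> is_derive y 1 (D j) (D j.+1 y)) ->
  forall vs, (size vs <= m)%N -> forall x : 'rV[R]_1, S (x 0 0) ->
  nderiv f vs x = (\prod_(v <- vs) v 0 0) * D (size vs) (x 0 0).
Proof.
move=> oS fD dD; elim => [|v vs IH] /= sm x Sx.
  by rewrite big_nil mul1r fD.
set c := \prod_(v <- vs) v 0 0.
transitivity ('D_v (fun y : 'rV[R]_1 => (c \*: D (size vs)) (y 0 0)) x).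
  apply: near_eq_derive.
  have cx := @coord_continuous R 1 1 0 0 x.
  have : \forall y \near x, S ((y : 'rV[R]_1) 0 0).
    by apply: cx; exact: open_nbhs_nbhs.
  by apply: filterS => y Sy; rewrite IH// ltnW.
have h : is_derive (x 0 0) 1 (c \*: D (size vs)) (c *: D (size vs).+1 (x 0 0)).
  by apply: is_deriveZ; exact: dD.
by rewrite (derive_coord _ h) big_cons -/c /GRing.scale /= mulrA.
Qed.

Lemma taylor_lift (R : realType) (S : set R) (m : nat) (D : nat -> R -> R)
    (f : 'rV[R]_1 -> R) :
  open S ->
  (forall x : 'rV[R]_1, S (x 0 0) -> f x = D 0%N (x 0 0)) ->
  (forall j (y : R), (j < m)%N -> S y -> is_derive y 1 (D j) (D j.+1 y)) ->
  forall j (x d : 'rV[R]_1), (j <= m)%N -> S (x 0 0) ->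
  taylor f j x d =
  \sum_(l < j.+1) (l`!%:R)^-1 * (d 0 0 ^+ l * D l (x 0 0)).
Proof.
move=> oS fD dD j x d jm Sx; apply: eq_bigr => l _; congr (_ * _).
have lm : (size (nseq l d) <= m)%N.
  by rewrite size_nseq (leq_trans _ jm)// -ltnS.
by rewrite (nderiv_lift oS fD dD)// size_nseq big_nseq iter_mulr_1.
Qed.

Lemma lipschitz_continuous1 (R : realType) (g : R -> R) (C : R) : 0 < C ->
  (forall x y, `|g x - g y| <= C * `|x - y|) -> continuous g.
Proof.
move=> C0 gC x; apply/cvgrPdist_lt => e e0.
have : \forall y \near x, `|x - y| < e / C.
  by apply: nbhsx_ballx; rewrite divr_gt0.
by apply: filterS => y xy; rewrite (le_lt_trans (gC _ _))// mulrC -ltr_pdivlMr.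
Qed.

Lemma smooth_lift (R : realType) (m : nat) (D : nat -> R -> R)
    (f : 'rV[R]_1 -> R) :
  (forall x, f x = D 0%N (x 0 0)) ->
  (forall j (y : R), (j < m)%N -> is_derive y 1 (D j) (D j.+1 y)) ->
  (forall j, (j <= m)%N -> continuous (D j)) ->
  times_cont_differentiable m f.
Proof.
move=> fD dD cD.
have nE vs : (size vs <= m)%N -> nderiv f vs =
    fun x : 'rV[R]_1 => ((\prod_(v <- vs) v 0 0) \*: D (size vs)) (x 0 0).
  move=> sm; apply/funext => x.
  by apply: (@nderiv_lift _ setT m D) => //; [exact: openT|move=> j y jm _; exact: dD].
split=> [vs x sm|vs sm].
  rewrite (nE vs (ltnW sm)); set c := \prod_(v <- vs) v 0 0.
  have h : is_derive (x 0 0) 1 (c \*: D (size vs)) (c *: D (size vs).+1 (x 0 0)).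
    by apply: is_deriveZ; exact: dD.
  exact: differentiable_coord1 h.
rewrite (nE vs sm); set c := \prod_(v <- vs) v 0 0 => x.
apply: (@continuous_comp _ _ _ (fun v : 'rV[R]_1 => v 0 0) (c \*: D (size vs))).
  exact: coord_continuous.
apply: cvgMl_tmp; exact: cD.
Qed.

Lemma tensor_norm_lift (R : realType) (m j : nat) (D : nat -> R -> R) (C : R)
    (f : 'rV[R]_1 -> R) (x y : 'rV[R]_1) :
  (forall x, f x = D 0%N (x 0 0)) ->
  (forall j (y : R), (j < m)%N -> is_derive y 1 (D j) (D j.+1 y)) ->
  (j <= m)%N ->
  (forall x y, `|D j x - D j y| <= C * `|x - y|) ->
  (tensor_norm (fun v : j.-tuple 'rV[R]_1 =>
                  (nderiv f v x - nderiv f v y)%R) <= (C * enorm (x - y))%:E)%E.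
Proof.
move=> fD dD jm DC; apply: ge_ereal_sup => _ [v /= v1 <-]; rewrite lee_fin.
have nE (z : 'rV[R]_1) :
    nderiv f v z = (\prod_(w <- v) w 0 0) * D (size v) (z 0 0).
  apply: (@nderiv_lift _ setT m D) => //; first exact: openT.
    by move=> i t im _; exact: dD.
  by rewrite size_tuple.
rewrite !nE size_tuple -mulrBr normrM normr_prod big1_seq ?mul1r.
  by rewrite enorm1 !mxE.
move=> w /andP[_ /tnthP[i ->]].
by rewrite -enorm1.
Qed.

Lemma phi_attained (R : realType) (n : nat) (G : set 'rV[R]_n)
    (g : 'rV[R]_n -> R) (j : nat) (delta : R) (x d : 'rV[R]_n) :
  trust_region G delta x d ->
  (forall d', trust_region G delta x d' -> taylor g j x d <= taylor g j x d') ->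
  phi G g j delta x = g x - taylor g j x d.
Proof.
move=> Gd dmin; congr (_ - _); apply/le_anti/andP; split.
  apply: ge_inf; last by exists d.
  by exists (taylor g j x d) => _ [d' Gd' <-]; exact: dmin.
apply: lb_le_inf; first by exists (taylor g j x d); exists d.
by move=> _ [d' Gd' <-]; exact: dmin.
Qed.

(** * The objective and the regularized model *)

(** The slope is scaled down to g, so that a model with unit regularization
    takes a step of length (g p!)^(1/p). *)
Definition objective (R : realType) (p : nat) (g : R) (v : 'rV[R]_1) : R :=
  - g * profile p 0 (v 0 0).

Lemma is_derive_objective (R : realType) (p : nat) (g : R) (j : nat) (y : R) :
  (j < p)%N ->
  is_derive y 1 (fun x => - g * profile p j x) (- g * profile p j.+1 y).
Proof.
move=> jp; have h := is_derive_profile y jp.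
exact: (is_deriveZ (- g) h).
Qed.

Lemma objective_le0 (R : realType) (p : nat) (g : R) (x : 'rV[R]_1) :
  x 0 0 <= 0 -> objective p g x = - g * x 0 0.
Proof. by move=> x0; rewrite /objective profile0_le0. Qed.

Lemma taylor_objective (R : realType) (p : nat) (g : R) (j : nat)
    (x d : 'rV[R]_1) : (1 <= j <= p)%N -> x 0 0 <= 0 ->
  taylor (objective p g) j x d = - g * (x 0 0 + d 0 0).
Proof.
move=> /andP[j1 jp] x0.
have dD i (y : R) : (i < p)%N -> [set: R] y ->
    is_derive y 1 (fun x => - g * profile p i x) (- g * profile p i.+1 y).
  by move=> ip _; exact: is_derive_objective.
have -> := @taylor_lift _ setT p (fun j y => - g * profile p j y)
  (objective p g) openT (fun=> fun=> erefl) dD j x d jp I.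
case: j j1 jp => // j _ jp.
rewrite big_ord_recl big_ord_recl /= big1 => [|i _].
  rewrite !fact0 profile0_le0// profile1_le0// invr1; ring.
by rewrite /bump /= !add1n profile_ge2_le0// !mulr0.
Qed.

Lemma objective_AS1 (R : realType) (p : nat) (L : nat -> R) (C g : R) :
  (0 < p)%N -> 1 <= C -> 0 <= g <= 1 ->
  (forall j x y, (1 <= j <= p)%N ->
     `|profile p j x - profile p j y| <= C * `|x - y|) ->
  (forall j, (1 <= j <= p)%N -> L j = C) ->
  AS1 p setT (objective p g) L.
Proof.
move=> p0 C1 /andP[g0 g1] Clip LC.
have C0 : 0 < C by exact: lt_le_trans C1.
have dD j (y : R) : (j < p)%N ->
    is_derive y 1 (fun x => - g * profile p j x) (- g * profile p j.+1 y).
  exact: is_derive_objective.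
have lipD j : (1 <= j <= p)%N -> forall x y,
    `|- g * profile p j x - - g * profile p j y| <= C * `|x - y|.
  move=> jp x y; rewrite -mulrBr normrM normrN (ger0_norm g0).
  apply: le_trans (Clip j x y jp); by rewrite ler_piMl.
split.
- apply: (@smooth_lift _ p (fun j y => - g * profile p j y)) => //.
  move=> [|j] jp; last by apply: (lipschitz_continuous1 C0); exact: lipD.
  move=> y; apply/differentiable_continuous/derivable1_diffP.
  by have [] := dD 0%N y p0.
- by move=> j jp; rewrite LC.
- exists setT; split => //; first exact: openT.
  move=> j x y jp _ _; rewrite LC//.
  apply: (@tensor_norm_lift _ p j (fun j y => - g * profile p j y)) => //.
    by case/andP: jp.
  exact: lipD.
Qed.

(** Left of the origin the Taylor models are linear, hence minimal at the right
    end of the trust region. *)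
Lemma objective_minimizer (R : realType) (p : nat) (g : R) (j : nat)
    (delta : R) (x : 'rV[R]_1) :
  (1 <= j <= p)%N -> x 0 0 <= 0 -> 0 <= g -> 0 <= delta ->
  trust_region setT delta x (const_mx delta) /\
  forall d, trust_region setT delta x d ->
    taylor (objective p g) j x (const_mx delta) <= taylor (objective p g) j x d.
Proof.
move=> jp x0 g0 delta0; split.
  by split=> //; rewrite enorm1 mxE ger0_norm.
move=> d [_]; rewrite enorm1 => /ler_normlP[_ dle].
rewrite !taylor_objective// mxE !mulNr lerN2 ler_wpM2l// lerD2l//.
Qed.

Lemma phi_objective (R : realType) (p : nat) (g : R) (j : nat)
    (delta : R) (x : 'rV[R]_1) :
  (1 <= j <= p)%N -> x 0 0 <= 0 -> 0 <= g -> 0 <= delta ->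
  phi setT (objective p g) j delta x = g * delta.
Proof.
move=> jp x0 g0 delta0.
have [tr mi] := objective_minimizer jp x0 g0 delta0.
rewrite (phi_attained tr mi) taylor_objective// objective_le0// mxE; ring.
Qed.

(** The quadratic term dominates the later ones: each of those carries a factor
    |d| / s <= 2^-n, and the binomial coefficients add up to at most 2^n. *)
Lemma binomial_tail_ge0 (R : realType) (n j : nat) (s d : R) :
  0 < s -> `|d| <= s / 2 ^+ n -> (j < n)%N ->
  0 <= \sum_(2 <= l < j.+1) 'C(n, l)%:R * s ^+ (n - l) * d ^+ l.
Proof.
move=> s0 ds jn; have [j2|j2] := ltnP j 2; first by rewrite big_geq.
have n2 : (2 <= n)%N by rewrite ltnW// (leq_ltn_trans j2).
have s0' := ltW s0.
have pow0 : 0 < 2 ^+ n :> R by rewrite exprn_gt0.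
rewrite big_ltn//.
set B := s ^+ (n - 2) * d ^+ 2.
have B0 : 0 <= B by rewrite mulr_ge0 ?sqr_ge0// exprn_ge0.
have tail : `|\sum_(3 <= l < j.+1) 'C(n, l)%:R * s ^+ (n - l) * d ^+ l| <= B.
  apply: le_trans (ler_norm_sum _ _ _) _.
  apply: (@le_trans _ _ (\sum_(3 <= l < j.+1) 'C(n, l)%:R * (B / 2 ^+ n))).
    rewrite big_nat_cond [leRHS]big_nat_cond; apply: ler_sum => l.
    rewrite andbT => /andP[l3 lj].
    rewrite -mulrA normrM ger0_norm// ler_wpM2l// normrM !normrX (gtr0_norm s0).
    have -> : l = (l - 3).+1.+2 by rewrite -[LHS](subnK l3) addn3.
    set i := (l - 3)%N.
    have -> : `|d| ^+ i.+3 = d ^+ 2 * `|d| ^+ i.+1.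
      by rewrite (exprD _ 2) real_normK ?num_real.
    have di : `|d| ^+ i.+1 <= s ^+ i.+1 / 2 ^+ n.
      apply: (@le_trans _ _ ((s / 2 ^+ n) ^+ i.+1)).
        by rewrite lerXn2r// nnegrE ?divr_ge0// ltW.
      rewrite expr_div_n ler_wpM2l ?exprn_ge0//.
      rewrite lef_pV2 ?posrE ?exprn_gt0// -exprM ler_weXn2l ?ler1n//.
      by rewrite leq_pmulr.
    have -> : B / 2 ^+ n = d ^+ 2 * (s ^+ (n - i.+3) * (s ^+ i.+1 / 2 ^+ n)).
      rewrite /B [s ^+ (n - _) * (_ / _)]mulrA -exprD.
      have -> : (n - i.+3 + i.+1 = n - 2)%N.
        rewrite /i; move: l3 lj jn; clear; lia.
      by rewrite -mulrA mulrCA.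
    by rewrite mulrCA ler_wpM2l ?sqr_ge0// ler_wpM2l// exprn_ge0.
  rewrite -mulr_suml -natr_sum mulrCA ler_piMr//.
  rewrite ler_pdivrMr// mul1r -natrX ler_nat.
  rewrite -[2%N]/(1 + 1)%N expnDn.
  under [leqRHS]eq_bigr do rewrite !exp1n !muln1.
  rewrite -(big_mkord xpredT (fun i => 'C(n, i))).
  rewrite (@big_cat_nat _ _ _ 3 0)//= ?(leq_trans n2)//.
  rewrite (@big_cat_nat _ _ _ j.+1 3 n.+1)//=.
    by rewrite addnCA leq_addr.
  by rewrite ltnS ltnW.
move: tail => /ler_normlP[tail _].
have : B <= 'C(n, 2)%:R * s ^+ (n - 2) * d ^+ 2.
  by rewrite -mulrA ler_peMl// ler1n bin_gt0.
by lra.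
Qed.

Lemma reg_model_objective (R : realType) (p : nat) (g : R) (x v : 'rV[R]_1) :
  (0 < p)%N -> x 0 0 <= 0 ->
  reg_model p (objective p g) x 1 v =
  - g * (x 0 0 + v 0 0) + (p.+1`!%:R)^-1 * `|v 0 0| ^+ p.+1.
Proof.
move=> p0 x0; rewrite /reg_model taylor_objective//; last by rewrite p0 leqnn.
by rewrite enorm1 div1r.
Qed.

Definition model_poly (R : realType) (p : nat) (c g : R) : {poly R} :=
  c%:P - g *: 'X + (p.+1`!%:R)^-1 *: 'X^(p.+1).

Lemma derivn_model_poly (R : realType) (p l : nat) (c g y : R) :
  (model_poly p c g)^`(l.+2).[y] =
  (p.+1`!%:R)^-1 * ((p.+1 ^_ l.+2)%:R * y ^+ (p.+1 - l.+2)).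
Proof.
rewrite /model_poly derivnD derivnB !derivnZ derivnXn derivnC.
rewrite (derivn_poly0 (p := 'X)) ?size_polyX//.
by rewrite scaler0 subr0 add0r hornerZ hornerMn hornerXn mulr_natl.
Qed.

(** At the step of length (g p!)^(1/p) the slope of the regularization term
    cancels the slope of the linear model, which leaves the terms of order two
    and more of the regularization. *)
Lemma taylor_reg_model (R : realType) (p j : nat) (g y : R)
    (x d : 'rV[R]_1) :
  (1 <= j <= p)%N -> x 0 0 <= 0 -> 0 < y -> y ^+ p = p`!%:R * g ->
  let m := reg_model p (objective p g) x 1 in
  taylor m j (const_mx y) d = m (const_mx y) + (p.+1`!%:R)^-1 *
    \sum_(2 <= l < j.+1) 'C(p.+1, l)%:R * y ^+ (p.+1 - l) * d 0 0 ^+ l.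
Proof.
move=> /andP[j1 jp] x0 y0 yp m.
have p0 : (0 < p)%N by exact: leq_trans jp.
set M := model_poly p (- g * x 0 0) g.
have mM (v : 'rV[R]_1) : [set t | 0 < t] (v 0 0) -> m v = M^`(0).[v 0 0].
  move=> v0; rewrite derivn0 /m reg_model_objective// gtr0_norm//.
  rewrite /M /model_poly !hornerE /=; ring.
have dM i (t : R) : (i < p)%N -> [set t : R | 0 < t] t ->
    is_derive t 1 (horner (M^`(i))) (M^`(i.+1)).[t].
  by move=> _ _; exact: is_derive_poly.
have oS : open [set t : R | 0 < t] by exact: open_gt.
have y0' : [set t : R | 0 < t] ((const_mx y : 'rV[R]_1) 0 0) by rewrite /= mxE.
have -> := @taylor_lift _ _ p (fun j => horner (M^`(j))) m oS mM dM
  j (const_mx y) d jp y0'.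
rewrite (mM _ y0') [const_mx y 0 0]mxE.
rewrite -(big_mkord xpredT (fun l => (l`!%:R)^-1 * (d 0 0 ^+ l * M^`(l).[y]))).
rewrite big_ltn// big_ltn// fact0 invr1 expr0 !mul1r.
have -> : M^`(1).[y] = 0.
  rewrite derivn1 /M /model_poly derivD derivB !derivZ derivX derivXn derivC /=.
  rewrite !hornerE hornerMn hornerXn yp factS natrM invfM -mulr_natl.
  have f0 : p`!%:R != 0 :> R by rewrite pnatr_eq0 -lt0n fact_gt0.
  have p1 : p.+1%:R != 0 :> R by rewrite pnatr_eq0.
  by field; rewrite f0 nat1r p1.
rewrite !mulr0 add0r; congr (_ + _); rewrite mulr_sumr.
rewrite big_nat [RHS]big_nat; apply: eq_bigr => -[|[|l]]// _.
rewrite derivn_model_poly -bin_ffact natrM.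
have l0 : (l.+2)`!%:R != 0 :> R by rewrite pnatr_eq0 -lt0n fact_gt0.
have p1 : (p.+1)`!%:R != 0 :> R by rewrite pnatr_eq0 -lt0n fact_gt0.
move: l0 p1; move: (_`!%:R) (_`!%:R) => a b a0 b0.
by field; rewrite a0 b0.
Qed.

Lemma reg_model_minimizer (R : realType) (p j : nat) (g y delta : R)
    (x : 'rV[R]_1) :
  (1 <= j <= p)%N -> x 0 0 <= 0 -> 0 < y -> y ^+ p = p`!%:R * g ->
  0 <= delta <= y / 2 ^+ p.+1 ->
  let m := reg_model p (objective p g) x 1 in
  trust_region [set u | setT (x + u)] delta (const_mx y) 0 /\
  forall d, trust_region [set u | setT (x + u)] delta (const_mx y) d ->
    taylor m j (const_mx y) 0 <= taylor m j (const_mx y) d.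
Proof.
move=> jp x0 y0 yp /andP[delta0 deltay] m; split.
  by split=> //; rewrite enorm1 mxE normr0.
move=> d [_]; rewrite enorm1 => ddelta.
rewrite !taylor_reg_model// lerD2l ler_wpM2l// ?invr_ge0// mxE.
rewrite [leLHS]big_nat big1 => [|[|[|l]]// _]; last by rewrite expr0n mulr0.
apply: binomial_tail_ge0 => //; last by case/andP: jp.
exact: le_trans deltay.
Qed.

Lemma phi_reg_model (R : realType) (p j : nat) (g y delta : R)
    (x : 'rV[R]_1) :
  (1 <= j <= p)%N -> x 0 0 <= 0 -> 0 < y -> y ^+ p = p`!%:R * g ->
  0 <= delta <= y / 2 ^+ p.+1 ->
  let m := reg_model p (objective p g) x 1 in
  phi [set u | setT (x + u)] m j delta (const_mx y) = 0.
Proof.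
move=> jp x0 y0 yp hdelta m.
have [tr mi] := reg_model_minimizer jp x0 y0 yp hdelta.
rewrite (phi_attained tr mi) taylor_reg_model// mxE.
rewrite big_nat big1 => [|[|[|l]]// _]; last by rewrite expr0n mulr0.
by rewrite mulr0 addr0 subrr.
Qed.

Lemma reg_model_decrease (R : realType) (p : nat) (g y : R) (x : 'rV[R]_1) :
  (0 < p)%N -> x 0 0 <= 0 -> 0 <= g -> 0 < y -> y ^+ p = p`!%:R * g ->
  reg_model p (objective p g) x 1 (const_mx y) <=
  reg_model p (objective p g) x 1 0.
Proof.
move=> p0 x0 g0 y0 yp; rewrite !reg_model_objective// !mxE normr0.
rewrite expr0n /= mulr0 !addr0 gtr0_norm// exprS yp factS natrM invfM.
have f0 : p`!%:R != 0 :> R by rewrite pnatr_eq0 -lt0n fact_gt0.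
have -> : p.+1%:R^-1 / p`!%:R * (y * (p`!%:R * g)) = p.+1%:R^-1 * (y * g).
  by field; rewrite f0 nat1r pnatr_eq0.
have : p.+1%:R^-1 * (y * g) <= y * g.
  by rewrite ler_piMl ?mulr_ge0 ?(ltW y0)// invf_le1// ler1n.
move: (_^-1 * _) => t ty.
have -> : - g * (x 0 0 + y) = - g * x 0 0 - y * g by ring.
by rewrite -addrA gerDl addrC subr_le0.
Qed.

(** * The slow run *)

(** The run visits these points from left to right and ends at the origin, for
    k = N. *)
Definition node (R : realType) (s : R) (N k : nat) : 'rV[R]_1 :=
  const_mx ((k%:R - N%:R) * s).

(** The doubling at the index N is what ends the run. *)
Definition radius (R : realType) (delta : R) (N k : nat) : R :=
  if (k < N)%N then delta else 2 * delta.

Definition slow_trace (R : realType) (s delta : R) (N : nat) : trace R 1 :=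
  Trace N (node s N) (fun=> const_mx s) (fun=> 1)
    (fun k _ => radius delta N k) (fun k _ => radius delta N k.+1).

Lemma node_le0 (R : realType) (s : R) (N k : nat) : 0 <= s -> (k <= N)%N ->
  node s N k 0 0 <= 0.
Proof.
by move=> s0 kN; rewrite mxE mulr_le0_ge0// subr_le0 ler_nat.
Qed.

Lemma nodeS (R : realType) (s : R) (N k : nat) :
  node s N k + const_mx s = node s N k.+1.
Proof. by apply/matrixP => i j; rewrite !mxE -natr1; ring. Qed.

Lemma radius_gt0 (R : realType) (delta : R) (N k : nat) : 0 < delta ->
  0 < radius delta N k.
Proof. by move=> d0; rewrite /radius; case: ifP => // _; rewrite mulr_gt0. Qed.

Lemma radius_le (R : realType) (delta : R) (N k : nat) : 0 < delta ->
  radius delta N k <= 2 * delta.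
Proof. by move=> d0; rewrite /radius; case: ifP => // _; rewrite ler_peMl ?(ltW d0)// ler1n. Qed.

(** Each step stays left of the origin, where the Taylor model is exact. *)
Lemma rho_slow_trace (R : realType) (p : nat) (g s delta : R) (N k : nat) :
  (0 < p)%N -> 0 < g -> 0 < s -> (k < N)%N ->
  rho p (objective p g) (slow_trace s delta N) k = 1.
Proof.
move=> p0 g0 s0 kN; rewrite /rho /= nodeS.
have le0 i : (i <= N)%N -> node s N i 0 0 <= 0 by exact/node_le0/ltW.
rewrite taylor_objective ?p0 ?leqnn ?le0 ?(ltnW kN)//.
rewrite !objective_le0 ?le0 ?(ltnW kN)// -nodeS [X in _ - _ * X]mxE.
rewrite divff//.
have -> : - g * node s N k 0 0 -
    - g * (node s N k 0 0 + (const_mx s : 'rV_1) 0 0) = g * s.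
  by rewrite [const_mx s 0 0]mxE; ring.
by rewrite mulf_neq0 ?gt_eqF.
Qed.

Lemma visited_slow_trace (R : realType) (p : nat) (P : parameters R)
    (g s delta : R) (N k : nat) :
  (0 < p)%N -> 0 < g -> 0 < s -> eta1 P <= 1 -> (k <= N)%N ->
  step1_visited p (objective p g) P (slow_trace s delta N) k.
Proof.
case: k => // k p0 g0 s0 e1 kN.
by rewrite /step1_visited /successful /= rho_slow_trace.
Qed.

Lemma test_fails (R : realType) (p q : nat) (g s delta eps : R) (N k : nat) :
  (0 < q <= p)%N -> 0 < g -> 0 < s -> 0 < delta -> (k < N)%N ->
  eps * delta ^+ q / q`!%:R < g * delta ->
  ~ step1_test q setT (objective p g) (fun=> eps) (slow_trace s delta N) k.
Proof.
move=> /andP[q0 qp] g0 s0 d0 kN fail /(_ q); rewrite q0 leqnn /= /radius kN.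
move=> /(_ isT); have x0 := node_le0 (ltW s0) (ltnW kN).
by rewrite phi_objective ?q0 ?(ltW g0) ?(ltW d0)// leNgt fail.
Qed.

Lemma test_succeeds (R : realType) (p q : nat) (g s delta eps : R) (N : nat) :
  (q <= p)%N -> 0 < g -> 0 < s -> 0 < delta ->
  (forall j, (1 <= j <= q)%N ->
     g * (2 * delta) <= eps * (2 * delta) ^+ j / j`!%:R) ->
  step1_test q setT (objective p g) (fun=> eps) (slow_trace s delta N) N.
Proof.
move=> qp g0 s0 d0 succ j jq; have /andP[j1 jq'] := jq.
have x0 := node_le0 (ltW s0) (leqnn N).
have d0' : 0 <= 2 * delta by rewrite mulr_ge0// ltW.
by rewrite /= /radius ltnn phi_objective ?succ ?j1 ?(leq_trans jq') ?(ltW g0).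
Qed.

(** The two conditions relating g and delta make the test fail before the index
    N and succeed there; the bound of 2 delta by s / 2^(p+1) makes each step
    acceptable. *)
Lemma slow_execution (R : realType) (p q : nat) (P : parameters R)
    (g s delta eps : R) (N : nat) :
  (0 < q <= p)%N ->
  [/\ 0 <= theta P, sigma0 P = 1, sigma_min P <= 1, gamma1 P <= 1 &
      eta1 P <= 1 /\ eta2 P <= 1] ->
  0 <= eps -> 0 < g -> 0 < s -> s ^+ p = p`!%:R * g ->
  0 < delta -> 2 * delta <= 1 -> 2 * delta <= s / 2 ^+ p.+1 ->
  eps * delta ^+ q / q`!%:R < g * delta ->
  (forall j, (1 <= j <= q)%N ->
     g * (2 * delta) <= eps * (2 * delta) ^+ j / j`!%:R) ->
  execution p q setT (objective p g) P (fun=> eps) (node s N 0)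
    (fun=> radius delta N 0) (slow_trace s delta N).
Proof.
move=> /andP[q0 qp] [th0 sig0 smin gam1 [et1 et2]] eps0 g0 s0 sp d0 d1 ds fail succ.
have p0 : (0 < p)%N by exact: leq_trans qp.
have node0 k : (k <= N)%N -> node s N k 0 0 <= 0 by exact/node_le0/ltW.
have rad0 k : 0 < radius delta N k by exact: radius_gt0.
have rad2 k : radius delta N k <= 2 * delta by exact: radius_le.
have jp j : (1 <= j <= q)%N -> (1 <= j <= p)%N.
  by move=> /andP[-> jq]; exact: leq_trans qp.
have radm k : 0 <= radius delta N k <= s / 2 ^+ p.+1.
  by rewrite ltW//= (le_trans (rad2 k)).
split.
- by split.
- move=> k kN; have kN' := ltnW kN.
  have rho1 := rho_slow_trace delta p0 g0 s0 kN.
  have su : successful p (objective p g) P (slow_trace s delta N) k.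
    by rewrite /successful rho1.
  split.
  + by move=> _; apply: (@test_fails R p q) => //; rewrite q0 qp.
  + split => /=.
    * apply/eqP => /matrixP/(_ 0 0); rewrite !mxE => s00.
      by rewrite s00 ltxx in s0.
    * by [].
    * by move=> j _; rewrite rad0/= (le_trans (rad2 _)).
    * by apply: reg_model_decrease; rewrite // ?node0// ltW.
    * move=> j jq; rewrite (@phi_reg_model R p j) ?jp ?node0//.
      by rewrite mulr_ge0 ?invr_ge0// !mulr_ge0// exprn_ge0// ltW.
  + by rewrite su /= nodeS.
  + by rewrite su.
  + by rewrite /sigma_update rho1 et2 /= ge_max smin mulr1 gam1 lexx.
- left; split; first exact: visited_slow_trace.
  exact: test_succeeds.
- move=> k kN j jq.
  have [tr mi] := objective_minimizer (jp j jq) (node0 k kN) (ltW g0) (ltW (rad0 k)).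
  by exists (const_mx (radius delta N k)).
- move=> k kN j jq.
  have [tr mi] := reg_model_minimizer (jp j jq) (node0 k (ltnW kN)) s0 sp (radm k.+1).
  by exists 0.
Qed.

(** Each of the first N visits to Step 1 fails its test, and so evaluates the
    derivatives of all orders. *)
Lemma slow_derivative_evaluations (R : realType) (p q l : nat)
    (P : parameters R) (g s delta eps : R) (N : nat) :
  (0 < q <= p)%N -> eta1 P <= 1 -> 0 < g -> 0 < s -> 0 < delta ->
  eps * delta ^+ q / q`!%:R < g * delta ->
  (N <= derivative_evaluations p q setT (objective p g) P (fun=> eps)
          (slow_trace s delta N) l)%N.
Proof.
move=> qp e1 g0 s0 d0 fail; have p0 : (0 < p)%N.
  by have /andP[q0 qp'] := qp; exact: leq_trans qp'.
rewrite /derivative_evaluations -[(niter _).+1]addn1 iotaD count_cat.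
apply: (@leq_trans (count xpredT (iota 0 N))).
  by rewrite count_predT size_iota.
apply: leq_trans (leq_addr _ _); apply: eq_leq; apply: eq_in_count => k.
rewrite mem_iota add0n => /andP[_ kN].
rewrite visited_slow_trace// ?(ltnW kN)//; apply/esym/orP; right.
by apply/asboolPn; exact: (@test_fails R p q).
Qed.

(** * Choice of the constants *)

(** Here r is the length of the step divided by eps^(q/p), with m = q - 1. Taking
    p-th powers, the last bound reduces to kappa 2^(p(p+2)) <= 1, since
    kappa^(p-1) <= kappa^m. *)
Lemma step_scale (R : realType) (p m : nat) (kappa : R) :
  (m < p)%N -> 0 < kappa <= (2 ^+ (p * p.+2))^-1 ->
  exists r : R, [/\ 0 < r,
    r ^+ p = p`!%:R * (2 * kappa ^+ m / m.+1`!%:R) &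
    kappa * 2 ^+ p.+2 <= r].
Proof.
move=> mp /andP[k0 kle]; have p0 : (0 < p)%N by exact: leq_ltn_trans mp.
have kle1 : kappa <= 1.
  by rewrite (le_trans kle)// invf_le1 ?exprn_gt0// exprn_ege1// ler1n.
set B := p`!%:R * _.
have f0 n : 0 < n`!%:R :> R by rewrite ltr0n fact_gt0.
have B0 : 0 < B by rewrite !mulr_gt0 ?invr_gt0 ?exprn_gt0.
exists (B `^ (p%:R^-1)).
have rp : (B `^ p%:R^-1) ^+ p = B.
  by rewrite -powR_mulrn ?powR_ge0// -powRrM mulVf ?powRr1 ?ltW// pnatr_eq0 -lt0n.
split; rewrite ?powR_gt0//.
have r0 : 0 <= kappa * 2 ^+ p.+2 by rewrite mulr_ge0 ?(ltW k0).
rewrite -(ler_pXn2r p0) ?nnegrE ?powR_ge0// rp exprMn -exprM mulnC.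
have -> : kappa ^+ p = kappa ^+ p.-1 * kappa by rewrite -exprSr prednK.
rewrite -mulrA; apply: (@le_trans _ _ (kappa ^+ p.-1)).
  rewrite ler_piMr ?exprn_ge0 ?(ltW k0)//.
  by rewrite -ler_pdivlMr ?exprn_gt0// mul1r.
apply: (@le_trans _ _ (kappa ^+ m)).
  apply: ler_wiXn2l; rewrite ?(ltW k0)//.
  by rewrite -ltnS prednK.
have -> : B = kappa ^+ m * (2 * (p`!%:R / m.+1`!%:R)) by rewrite /B; ring.
rewrite ler_peMr ?exprn_ge0 ?(ltW k0)//.
have : 1 <= p`!%:R / m.+1`!%:R :> R.
  by rewrite ler_pdivlMr// mul1r ler_nat leq_fact.
lra.
Qed.

(** Radii kappa eps are too small by a factor two for the test of the top
    order. After doubling them, the factor 2^(j-1) in the test of order j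
    compensates the factor 2 in g when j >= 2; for j = 1 this is done by 1/q!,
    where q = m + 1 >= 2. *)
Lemma radius_thresholds (R : realType) (m : nat) (kappa eps : R) :
  (0 < m)%N -> 0 < kappa <= 1 -> 0 < eps <= 1 ->
  let g := 2 * kappa ^+ m / m.+1`!%:R * eps ^+ m.+1 in
  let delta := kappa * eps in
  eps * delta ^+ m.+1 / m.+1`!%:R < g * delta /\
  forall j, (1 <= j <= m.+1)%N ->
    g * (2 * delta) <= eps * (2 * delta) ^+ j / j`!%:R.
Proof.
move=> m0 /andP[k0 k1] /andP[e0 e1] g delta.
have f0 n : 0 < n`!%:R :> R by rewrite ltr0n fact_gt0.
have d0 : 0 < delta by exact: mulr_gt0.
have gE : g * delta = 2 * (eps * delta ^+ m.+1 / m.+1`!%:R).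
  by rewrite /g /delta exprMn !exprS; ring.
split.
  rewrite gE ltr_pMl ?ltr1n//.
  by rewrite !mulr_gt0 ?invr_gt0 ?exprn_gt0.
case=> // i; rewrite ltnS => im.
have -> : eps * (2 * delta) ^+ i.+1 / i.+1`!%:R =
    eps * (2 * delta) ^+ i / i.+1`!%:R * (2 * delta) by rewrite exprS; ring.
rewrite ler_pM2r ?mulr_gt0//.
have -> : eps * (2 * delta) ^+ i / i.+1`!%:R =
    2 ^+ i / i.+1`!%:R * (kappa ^+ i * eps ^+ i.+1).
  by rewrite /delta !exprMn exprS; ring.
have -> : g = 2 / m.+1`!%:R * (kappa ^+ m * eps ^+ m.+1) by rewrite /g; ring.
apply: ler_pM.
- by rewrite divr_ge0// ltW.
- by rewrite mulr_ge0 ?exprn_ge0 ?ltW.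
- case: i im => [|i] im.
    rewrite expr0 divr1 ler_pdivrMr// mul1r.
    by rewrite ler_nat (@leq_fact 2 m.+1).
  apply: ler_pM; rewrite ?invr_ge0//.
    by rewrite exprS ler_peMr// exprn_ege1// ler1n.
  by rewrite lef_pV2 ?posrE// ler_nat leq_fact.
- by apply: ler_pM; rewrite ?exprn_ge0 ?ler_wiXn2l ?(ltW k0) ?(ltW e0).
Qed.

Lemma kappa_delta_min_bounds (R : realType) (p q : nat) (L : nat -> R)
    (P : parameters R) : 0 < theta P -> 1 <= L 0%N -> sigma0 P = 1 ->
  0 < kappa_delta_min p q L P <= theta P.
Proof.
move=> th0 L0 sig; rewrite /kappa_delta_min.
have Lw1 : 1 <= Lw p L by apply: le_trans L0 _; exact: bigmax_ge_id.
have sm1 : 1 <= sigma_max p L P by rewrite /sigma_max sig le_max lexx.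
have f1 : 1 <= q`!%:R :> R by rewrite ler1n fact_gt0.
set D := 2 * _ * _.
have D1 : 1 <= D.
  rewrite /D mulr_ege1//; last by lra.
  by rewrite mulr_ege1// ler1n.
have D0 : 0 < D by exact: lt_le_trans D1.
by rewrite divr_gt0//= ler_pdivrMr// ler_peMr// ltW.
Qed.

(* The problem may depend on eps, but its Lipschitz constants, lower bound and
   initial value and the parameters of the algorithm are bounded or fixed
   independently of eps; L 0 plays the role of the given constant L_{f,0}. *)
Theorem theorem6p4 (R : realType) (p q : nat) (hq : (2 <= q)%N)
    (hqp : (q <= p)%N) (L0 : R) (hL0 : 1 <= L0) :
  exists (L : nat -> R) (wlow wbar : R) (P : parameters R),
  [/\ L 0%N = L0, valid_parameters P &
  forall eps : R, 0 < eps < 1 ->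
  exists (n : nat) (F : set 'rV[R]_n) (f : 'rV[R]_n -> R) (x0 : 'rV[R]_n)
         (delta0 : nat -> R) (t : trace R n),
  [/\
      [/\ (1 <= n)%N,
          (2 < q)%N \/ (q = 2%N /\ F = setT),
          AS1 p F f L,
          AS4 F f wlow &
          F x0 /\ f x0 <= wbar],
      [/\ radii q delta0,
          execution p q F f P (fun=> eps) x0 delta0 t &
          forall k j, (k <= niter t)%N -> (1 <= j <= q)%N ->
            kappa_delta_min p q L P * eps <= delta t k j],
      (exists delta_eps : nat -> R,
         [/\ radii q delta_eps,
             minima_attained q F f delta_eps (iterate t (niter t)) &
             approx_minimizer q F f (fun=> eps) delta_eps
               (iterate t (niter t))]) &
      let N := eps `^ (- (q%:R * p.+1%:R / p%:R)) in
      [/\ N <= (niter t)%:R,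
          N <= (function_evaluations t)%:R &
          forall l, (1 <= l <= p)%N ->
            N <= (derivative_evaluations p q F f P (fun=> eps) t l)%:R]]].
Proof.
have p0 : (0 < p)%N by rewrite (leq_trans _ hqp)// ltnW.
have [C [C1 Cprof Clip]] := @profile_bounds R p p0.
pose L j := if j == 0%N then L0 else C.
(* sigma stays at its initial value 1. Since kappa <= theta, the value of theta
   is the one that step_scale asks for. *)
pose P := MkParameters ((2 ^+ (p * p.+2))^-1 : R) 1 1 4^-1 2^-1 2^-1 2 3.
have th0 : 0 < theta P by rewrite invr_gt0 exprn_gt0.
have th2 : theta P <= 2^-1.
  rewrite /= lef_pV2 ?posrE ?exprn_gt0//.
  by rewrite -[leLHS]expr1 ler_weXn2l ?ler1n// muln_gt0 p0.
case: q hq hqp => // m m0 mp.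
have := kappa_delta_min_bounds p m.+1 th0 (hL0 : 1 <= L 0%N) (erefl : sigma0 P = 1).
move kE : (kappa_delta_min p m.+1 L P) => kappa /andP[k0 kth].
have k2 : 2 * kappa <= 1 by lra.
have k1 : kappa <= 1 by lra.
have [r [r0 rp kr]] : exists r : R, [/\ 0 < r,
    r ^+ p = p`!%:R * (2 * kappa ^+ m / m.+1`!%:R) & kappa * 2 ^+ p.+2 <= r].
  by apply: step_scale; rewrite ?k0.
set A := 2 * kappa ^+ m / m.+1`!%:R in rp.
have f0 n : 0 < n`!%:R :> R by rewrite ltr0n fact_gt0.
have A0 : 0 < A by rewrite !mulr_gt0 ?invr_gt0 ?exprn_gt0.
have A1 : A <= 1.
  rewrite ler_pdivrMr// mul1r (@le_trans _ _ 1)//; last by rewrite ler1n fact_gt0.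
  rewrite (le_trans _ k2)// ler_pM2l//.
  by rewrite -[leRHS]expr1 ler_wiXn2l// ltW.
have th1 : theta P < 1 by lra.
(* The initial value is N g s with g s = A r a^(p+1) and N <= 1 + a^(-(p+1)). *)
exists L, (- C), (2 * A * r), P; split => //.
  split; rewrite ?th0 ?th1 //=; first 1 [by rewrite ltr01 lexx|split|idtac|idtac]; lra.
move=> eps /andP[e0 e1].
(* The length of the step is r a, and a^(-(p+1)) is the required count. *)
pose a := eps `^ (m.+1%:R / p%:R).
have a0 : 0 < a by exact: powR_gt0.
have pn0 : p%:R != 0 :> R by rewrite pnatr_eq0 -lt0n.
have ap : a ^+ p = eps ^+ m.+1.
  by rewrite -powR_mulrn ?(ltW a0)// -powRrM mulfVK// powR_mulrn ?(ltW e0).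
have ea : eps <= a.
  rewrite -(ler_pXn2r p0) ?nnegrE ?(ltW a0) ?(ltW e0)// ap.
  by rewrite ler_wiXn2l ?(ltW e0) ?(ltW e1).
have a1 : a <= 1.
  rewrite -(ler_pXn2r p0) ?nnegrE ?(ltW a0)// ap expr1n.
  by apply: exprn_ile1; apply: ltW.
pose s := r * a; pose g := A * eps ^+ m.+1; pose delta := kappa * eps.
have s0 : 0 < s by exact: mulr_gt0.
have g0 : 0 < g by rewrite mulr_gt0// exprn_gt0.
have g1 : g <= 1.
  apply: mulr_ile1; rewrite ?(ltW A0) ?exprn_ge0 ?(ltW e0)//.
  by apply: exprn_ile1; apply: ltW.
have d0 : 0 < delta by exact: mulr_gt0.
have sp : s ^+ p = p`!%:R * g by rewrite exprMn rp ap /g; ring.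
have d1 : 2 * delta <= 1.
  by rewrite /delta mulrA; apply: mulr_ile1; rewrite ?mulr_ge0 ?(ltW k0) ?(ltW e0) ?(ltW e1).
have ds : 2 * delta <= s / 2 ^+ p.+1.
  rewrite ler_pdivlMr ?exprn_gt0//.
  have -> : 2 * delta * 2 ^+ p.+1 = kappa * 2 ^+ p.+2 * eps.
    by rewrite /delta [in RHS]exprS; ring.
  by apply: ler_pM => //; rewrite ?(ltW e0)// mulr_ge0 ?exprn_ge0 ?(ltW k0).
have [fail succ] := @radius_thresholds R m kappa eps m0
  (introT andP (conj k0 k1)) (introT andP (conj e0 (ltW e1))).
rewrite -/A -/g -/delta in fail succ.
set X := eps `^ _.
have XE : X = (a ^+ p.+1)^-1.
  rewrite /X powRN -powR_mulrn ?(ltW a0)// /a -powRrM.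
  by congr (_ `^ _)^-1; rewrite mulrAC.
have X0 : 0 <= X by exact: powR_ge0.
pose N := (Num.truncn X).+1.
have XN : X <= N%:R by apply/ltW; exact: truncnS_gt.
have NX : N%:R <= 1 + X by rewrite -nat1r lerD2l truncn_le.
have kd k : kappa * eps <= radius delta N k.
  by rewrite /radius; case: ifP => // _; rewrite -/delta ler_peMl ?(ltW d0)// ler1n.
have qp : (0 < m.+1 <= p)%N by rewrite mp.
have Pval : [/\ 0 <= theta P, sigma0 P = 1, sigma_min P <= 1, gamma1 P <= 1 &
      eta1 P <= 1 /\ eta2 P <= 1].
  by split; rewrite ?(ltW th0)//=; [lra|split; lra].
have ex := @slow_execution R p m.+1 P g s delta eps N qp Pval (ltW e0) g0 s0 sp
  d0 d1 ds fail succ.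
exists 1%N, setT, (objective p g), (node s N 0), (fun=> radius delta N 0),
  (slow_trace s delta N).
have radq k : radii m.+1 (fun=> radius delta N k).
  by move=> j _; rewrite radius_gt0//= (le_trans (radius_le N k d0)).
split.
- split => //.
  + by move: m0; rewrite ltnS leq_eqVlt => /predU1P[<-|]; [right|left].
  + apply: (@objective_AS1 R p L C g) => //; first by rewrite (ltW g0) g1.
    by move=> j /andP[j1 _]; rewrite /L gtn_eqF.
  + move=> x _; rewrite /objective mulNr lerN2.
    apply: (@le_trans _ _ (g * C)); first by rewrite ler_wpM2l ?(ltW g0).
    by rewrite ler_piMl// (le_trans _ C1).
  + split => //; rewrite objective_le0; last by rewrite node_le0 ?(ltW s0).
    rewrite mxE; have -> : - g * ((0%:R - N%:R) * s) =
        A * r * (N%:R * a ^+ p.+1).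
      by rewrite /g /s -ap exprSr; ring.
    have -> : 2 * A * r = A * r * 2 by ring.
    rewrite (ler_pM2l (mulr_gt0 A0 r0)).
    apply: (@le_trans _ _ ((1 + X) * a ^+ p.+1)).
      by rewrite ler_wpM2r// exprn_ge0 ?(ltW a0).
    rewrite mulrDl mul1r XE mulVf ?expf_neq0 ?gt_eqF//.
    have : a ^+ p.+1 <= 1 by apply: exprn_ile1 => //; exact: ltW.
    lra.
- by split => // k j _ _; rewrite kE; exact: kd.
- exists (fun=> radius delta N N); split.
  + exact: radq.
  + by have [_ _ _ h _] := ex; exact: (h N).
  + exact: (@test_succeeds R p m.+1).
- split; first exact: XN.
    by rewrite (le_trans XN)// ler_nat.
  move=> l _; rewrite (le_trans XN)// ler_nat.
  apply: slow_derivative_evaluations => //=; lra.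
Qed.
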